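(* Let the data distributions $\mathcal{D}_{\mathrm{train}},\mathcal{D}_{\mathrm{test}}$, the Transformer architecture $P_\theta$, the few-shot training loss $\widehat{L}_{\mathrm{train}}(\theta)$ and the testing losses $L^k_{\mathrm{test}}(\theta)$ be as in the context. For every $\epsilon>0$ there exists a Transformer with parameters $\theta^*$ such that $\big|\widehat{L}_{\mathrm{train}}(\theta^* )-\inf_\theta\widehat{L}_{\mathrm{train}}(\theta)\big|<\epsilon$ and, for $k=2,\dots,K$, $L^k_{\mathrm{test}}(\theta^* )=-1$, i.e. $\Pr_{\mathcal{D}_{\mathrm{test}}}\big[\mathrm{dec}(\mathrm{model}_{\theta^*}(\widetilde{\mathtt{inp}}^k))=\mathrm{dec}(\widetilde{\mathtt{lab}}^k)\big]=1$ (the minimal possible testing loss).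
   Context: Causal structure: $\mathcal{V}_{\mathrm{all}}$ a finite alphabet of vertex symbols, $G=(V,E)$ a directed graph with $V\subseteq\mathcal{V}_{\mathrm{all}}$; each $v\in\mathcal{V}_{\mathrm{all}}$ has a finite value set $\mathtt{VALS}(v)\subset\mathbb{Z}$ and a finite nonempty context-token set $\mathtt{CONT}(v)$ (pairwise disjoint, disjoint from vertices and values); each edge $e=(v_1,v_2)$ carries $\mathtt{op}(e):q\mapsto q+c_e$ mapping $\mathtt{VALS}(v_1)$ into $\mathtt{VALS}(v_2)$. Chains $\mathcal{T}(G)$ are vertex lists with consecutive pairs in $E$; $N$ is the maximal chain length. Special tokens $o^{\mathrm{eq}}$ (''=''), $o^{\mathrm{cm}}$ ('',''), $o^{\mathrm{qu}}$ (''?''), $o^{\mathrm{dlm}}$ (newline); $\mathcal{A}$ is the set of all tokens. Sequences: training sequences interleave a chain $[u_1,\dots,u_M]\in\mathcal{T}(G)$ ($M<N$) with noise vertices from $\mathcal{V}_{\mathrm{all}}\setminus V$ preserving orders; chain values start uniform in $\mathtt{VALS}(u_1)$ and follow $q(u_h)=\mathtt{op}(u_{h-1},u_h)(q(u_{h-1}))$, noise values are uniform in their $\mathtt{VALS}$. Test sequences are chains of length $N$ with values generated the same way, no noise. A sequence $[v_1,q_1,\dots,v_L,q_L]$ is processed into $[v_L,o^{\mathrm{eq}},o^{\mathrm{qu}},c(v_1)_{1..l_1},v_1,o^{\mathrm{eq}},q_1,o^{\mathrm{cm}},\dots,o^{\mathrm{cm}},c(v_L)_{1..l_L},v_L,o^{\mathrm{eq}},q_L]$,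 with $l_i\sim\mathrm{Uniform}\{1,\dots,|\mathtt{CONT}(v_i)|\}$ and the $c(v_i)_\cdot$ drawn from $\mathtt{CONT}(v_i)$ without replacement. For $k\in\{0,\dots,K\}$, a $k$-shot input $\widetilde{\mathtt{inp}}^k$ is $k$ processed sequences with the same vertex list (independent values and context tokens) separated by $o^{\mathrm{dlm}}$, then $o^{\mathrm{dlm}}$, then the prefix of a further such processed sequence up to and including its first $o^{\mathrm{cm}}$; the label $\widetilde{\mathtt{lab}}^k$ (length $d^k$) is the rest of that sequence. $\mathcal{D}_{\mathrm{train}}$/$\mathcal{D}_{\mathrm{test}}$ use training/test sequences. $\mathrm{dec}$ extracts from a processed token string the list of vertex–value pairs (vertex and value in each ''vertex, $o^{\mathrm{eq}}$, value''). Transformer: embedding $x_t=W_E(z_t,t)\in\mathbb{R}^d$; layers $x^{(l)}_t=x^{(l-1)}_t+\sum_{h}W_V^{l,h}x^{(l-1)}_{1:t}\,\mathrm{softmax}\big((x^{(l-1)}_{1:t})^\top(W_K^{l,h})^\top W_Q^{l,h}x^{(l-1)}_t\big)$; output $P_\theta(\cdot\mid z_{1:T})=\mathrm{softmax}\big(W_{O_2}\mathrm{relu}(W_{O_1}x^{(L)}_T+W_B)\big)$ over $\mathcal{A}$; $\theta$ is the collection of parameters. $\mathrm{model}_\theta(z)$ is greedy decoding: repeatedly append an argmax token of $P_\theta$ given the current sentence, until the value of the goal vertex (named at the start of the current sequence) is produced. Losses: $\widehat{L}_{\mathrm{train}}(\theta)=-\mathbb{E}_{\mathcal{D}_{\mathrm{train}}}\sum_{k=1}^{K-1}\sum_{t=1}^{d^k-1}\log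 P_\theta\big(\widetilde{\mathtt{lab}}^k_{t+1}\mid\widetilde{\mathtt{inp}}^k+\widetilde{\mathtt{lab}}^k_{1:t}\big)$ and $L^k_{\mathrm{test}}(\theta)=-\Pr_{\mathcal{D}_{\mathrm{test}}}\big[\mathrm{dec}(\mathrm{model}_\theta(\widetilde{\mathtt{inp}}^k))=\mathrm{dec}(\widetilde{\mathtt{lab}}^k)\big]$. *)

(* Defs.v *)
From HB Require Import structures.
From mathcomp Require Import all_boot all_order all_algebra.
From mathcomp Require Import boolp classical_sets reals sequences exp.

Set Implicit Arguments.
Unset Strict Implicit.
Unset Printing Implicit Defensive.

Import Order.TTheory GRing.Theory Num.Theory.
Local Open Scope ring_scope.

Section Tokens.
Variables (V C : eqType).

Inductive tok : Type :=
  | TV of V        (* vertex symbol *)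
  | TVal of int
  | TC of C        (* context token *)
  | TEq
  | TCm            (* o^cm  "," *)
  | TQu            (* o^qu  "?" *)
  | TDlm.          (* o^dlm newline *)

Definition tok_enc (t : tok) : ((V + int) + C) + nat :=
  match t with
  | TV v => inl (inl (inl v))
  | TVal q => inl (inl (inr q))
  | TC c => inl (inr c)
  | TEq => inr 0%N | TCm => inr 1%N | TQu => inr 2%N | TDlm => inr 3%N
  end.

Definition tok_dec (x : ((V + int) + C) + nat) : option tok :=
  match x with
  | inl (inl (inl v)) => Some (TV v)
  | inl (inl (inr q)) => Some (TVal q)
  | inl (inr c) => Some (TC c)
  | inr 0%N => Some TEq | inr 1%N => Some TCm | inr 2%N => Some TQu
  | inr 3%N => Some TDlm | inr _ => None
  end.

Lemma tok_encK : pcancel tok_enc tok_dec.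
Proof. by case. Qed.

HB.instance Definition _ := Equality.copy tok (pcan_type tok_encK).

Fixpoint dec (s : seq tok) : seq (V * int) :=
  match s with
  | TV v :: TEq :: TVal q :: r => (v, q) :: dec r
  | _ :: r => dec r
  | [::] => [::]
  end.

End Tokens.

Arguments TV {V C}.
Arguments TVal {V C}.
Arguments TC {V C}.
Arguments TEq {V C}.
Arguments TCm {V C}.
Arguments TQu {V C}.
Arguments TDlm {V C}.


Section Dist.
Variable R : realType.

Definition dist (T : Type) := seq (R * T).

Definition dret (T : Type) (x : T) : dist T := [:: (1, x)].

Definition dbind (A B : Type) (d : dist A) (f : A -> dist B) : dist B :=
  flatten [seq [seq (p.1 * q.1, q.2) | q <- f p.2] | p <- d].

Definition dunif (T : Type) (s : seq T) : dist T :=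
  [seq ((size s)%:R^-1, x) | x <- s].

Definition expect (T : Type) (d : dist T) (f : T -> R) : R :=
  \sum_(p <- d) p.1 * f p.2.

Definition prob (T : Type) (d : dist T) (P : T -> Prop) : R :=
  \sum_(p <- d | `[< P p.2 >]) p.1.

Definition is_dist (T : Type) (d : dist T) : Prop :=
  (forall p, p \in map fst d -> 0 <= p) /\ \sum_(p <- d) p.1 = 1.

Fixpoint draw (T : eqType) (l : nat) (S : seq T) : dist (seq T) :=
  match l with
  | 0 => dret [::]
  | l'.+1 => dbind (dunif S) (fun c =>
             dbind (draw l' (rem c S)) (fun r => dret (c :: r)))
  end.

End Dist.

Record cstruct (Vall Ct : finType) := CStruct {
  cV : {set Vall};
  cE : rel Vall;
  cVALS : Vall -> seq int;
  cCONT : Vall -> {set Ct};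
  cop : Vall -> Vall -> int       (* op(e) : q |-> q + cop v1 v2 for e=(v1,v2) *)
}.

Section Causal.
Variables (Vall Ct : finType) (S : cstruct Vall Ct).

Definition wf_cstruct : Prop :=
  [/\ (forall u v, cE S u v -> (u \in cV S) && (v \in cV S)),
      (forall v, uniq (cVALS S v) /\ cVALS S v != [::]),
      (forall v, (0 < #|cCONT S v|)%N),
      (forall u v, u != v -> [disjoint cCONT S u & cCONT S v]) &
      (forall u v, cE S u v -> forall q, q \in cVALS S u ->
                     q + cop S u v \in cVALS S v)].

Definition is_chain (s : seq Vall) : bool :=
  if s is u :: s' then (u \in cV S) && path (cE S) u s' else false.

Definition max_chain_len (N : nat) : Prop :=
  (forall s, is_chain s -> size s <= N)%N /\
  (exists s, is_chain s /\ size s = N).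

(* training skeleton: a chain of length M < N interleaved (order-preserving)
   with noise vertices from V_all \ V *)
Definition train_skel (N : nat) (s : seq Vall) : bool :=
  is_chain [seq v <- s | v \in cV S] && (size [seq v <- s | v \in cV S] < N)%N.

Definition test_skel (N : nat) (s : seq Vall) : bool :=
  is_chain s && (size s == N).

Notation ttok := (tok Vall Ct).

Definition alphabet : seq ttok :=
  undup ([seq TV v | v <- enum Vall] ++
         [seq TVal q | q <- flatten [seq cVALS S v | v <- enum Vall]] ++
         [seq TC c | c <- enum Ct & [exists v, c \in cCONT S v]] ++
         [:: TEq; TCm; TQu; TDlm]).

Variable R : realType.

Fixpoint gvals (prev : option (Vall * int)) (s : seq Vall) : dist R (seq int) :=
  match s with
  | [::] => dret R [::]
  | v :: s' =>
    if v \in cV S then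
      dbind (match prev with
             | None => dunif R (cVALS S v)
             | Some (u, q) => dret R (q + cop S u v)
             end)
            (fun q => dbind (gvals (Some (v, q)) s')
                            (fun qs => dret R (q :: qs)))
    else
      dbind (dunif R (cVALS S v))
            (fun q => dbind (gvals prev s') (fun qs => dret R (q :: qs)))
  end.

Definition ctx (v : Vall) : dist R (seq Ct) :=
  dbind (dunif R (iota 1 #|cCONT S v|))
        (fun l => draw R l (enum (cCONT S v))).

Fixpoint bodies (ps : seq (Vall * int)) : dist R (seq (seq ttok)) :=
  match ps with
  | [::] => dret R [::]
  | (v, q) :: ps' =>
    dbind (ctx v) (fun cs => dbind (bodies ps') (fun bs =>
      dret R ((map (TC) cs ++ [:: TV v; TEq; TVal q]) :: bs)))
  end.

Definition assemble (vL : Vall) (bs : seq (seq ttok)) : seq ttok :=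
  [:: TV vL; TEq; TQu] ++
  match bs with
  | [::] => [::]
  | b :: bs' => b ++ flatten [seq TCm :: b' | b' <- bs']
  end.

Definition sample_seq (s : seq Vall) : dist R (seq ttok) :=
  match s with
  | [::] => dret R [::]
  | v :: s' =>
    dbind (gvals None s) (fun qs =>
    dbind (bodies (zip s qs)) (fun bs => dret R (assemble (last v s') bs)))
  end.

Fixpoint shots (n : nat) (s : seq Vall) : dist R (seq (seq ttok)) :=
  match n with
  | 0 => dret R [::]
  | n'.+1 => dbind (sample_seq s) (fun x =>
             dbind (shots n' s) (fun xs => dret R (x :: xs)))
  end.

Definition split_cm (p : seq ttok) : seq ttok * seq ttok :=
  let i := index (TCm) p in (take i.+1 p, drop i.+1 p).

Definition kshot (k : nat) (s : seq Vall) : dist R (seq ttok * seq ttok) :=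
  dbind (shots k.+1 s) (fun ss =>
    let pre := take k ss in
    let cur := split_cm (nth [::] ss k) in
    dret R (flatten [seq x ++ [:: TDlm] | x <- pre] ++ cur.1, cur.2)).

Definition Dk (Dsk : dist R (seq Vall)) (k : nat) : dist R (seq ttok * seq ttok) :=
  dbind Dsk (kshot k).

Record tparams := TP {
  td : nat;
  tL : nat;
  tH : nat;
  tdh : nat;
  tWE : ttok -> nat -> 'cV[R]_td;
  tWQ : 'I_tL -> 'I_tH -> 'M[R]_td;
  tWK : 'I_tL -> 'I_tH -> 'M[R]_td;
  tWV : 'I_tL -> 'I_tH -> 'M[R]_td;
  tWO1 : 'M[R]_(tdh, td);
  tWB : 'cV[R]_tdh;
  tWO2 : ttok -> 'rV[R]_tdh                (* rows of W_{O_2}, indexed by A *)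
}.

Arguments td : clear implicits.
Arguments tL : clear implicits.
Arguments tH : clear implicits.
Arguments tdh : clear implicits.
Arguments tWE : clear implicits.
Arguments tWQ : clear implicits.
Arguments tWK : clear implicits.
Arguments tWV : clear implicits.
Arguments tWO1 : clear implicits.
Arguments tWB : clear implicits.
Arguments tWO2 : clear implicits.

Section Forward.
Variable th : tparams.

Definition embed (z : seq ttok) : seq 'cV[R]_(td th) :=
  [seq tWE th p.1 p.2 | p <- zip z (iota 0 (size z))].

(* W_V x_{1:t} softmax(x_{1:t}^T W_K^T W_Q x_t)   (t is 0-based here) *)
Definition attn (Q K W : 'M[R]_(td th)) (xs : seq 'cV[R]_(td th)) (t : nat)
  : 'cV[R]_(td th) :=
  let pre := take t.+1 xs in
  let xt := nth 0 xs t in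
  let sc (x : 'cV[R]_(td th)) := ((K *m x)^T *m (Q *m xt)) 0 0 in
  let Z := \sum_(x <- pre) expR (sc x) in
  \sum_(x <- pre) (expR (sc x) / Z) *: (W *m x).

Definition layer (l : 'I_(tL th)) (xs : seq 'cV[R]_(td th)) : seq 'cV[R]_(td th) :=
  [seq nth 0 xs t + \sum_(h < tH th) attn (tWQ th l h) (tWK th l h) (tWV th l h) xs t
  | t <- iota 0 (size xs)].

Definition forward (z : seq ttok) : seq 'cV[R]_(td th) :=
  foldl (fun xs l => layer l xs) (embed z) (enum 'I_(tL th)).

Definition relu (n : nat) (x : 'cV[R]_n) : 'cV[R]_n := map_mx (fun r => Num.max r 0) x.

Definition logit (z : seq ttok) (a : ttok) : R :=
  (tWO2 th a *m relu (tWO1 th *m last 0 (forward z) + tWB th)) 0 0.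

Definition Pth (z : seq ttok) (a : ttok) : R :=
  expR (logit z a) / \sum_(b <- alphabet) expR (logit z b).

End Forward.

Definition Ltrain (Dtr : dist R (seq Vall)) (K : nat) (th : tparams) : R :=
  - \sum_(1 <= k < K)
      expect (Dk Dtr k) (fun il =>
        \sum_(1 <= t < size il.2)
          ln (Pth th (il.1 ++ take t il.2) (nth (TDlm) il.2 t))).

Definition argmax_sel (th : tparams) (sel : seq ttok -> ttok) : Prop :=
  forall z, sel z \in alphabet /\
            forall b, b \in alphabet -> Pth th z b <= Pth th z (sel z).

(* goal vertex token: the token starting the current (last) sequence *)
Definition goal (inp : seq ttok) : ttok :=
  nth (TQu) inp (size inp - index (TDlm) (rev inp)).

Definition stopped (g : ttok) (out : seq ttok) : bool :=
  match rev out with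
  | TVal _ :: TEq :: g' :: _ => g' == g
  | _ => false
  end.

Fixpoint greedy (sel : seq ttok -> ttok) (g : ttok) (fuel : nat)
  (z out : seq ttok) : option (seq ttok) :=
  match fuel with
  | 0 => None
  | f.+1 => let out' := rcons out (sel (z ++ out)) in
            if stopped g out' then Some out' else greedy sel g f z out'
  end.

Definition success (sel : seq ttok -> ttok) (inp lab : seq ttok) : Prop :=
  exists fuel out, greedy sel (goal inp) fuel inp [::] = Some out /\
                   dec out = dec lab.

Definition test_acc (Dte : dist R (seq Vall)) (k : nat)
  (sel : seq ttok -> ttok) : R :=
  prob (Dk Dte k) (fun il => success sel il.1 il.2).

End Causal.

(* Main.v *)
Require Import Defs.
From HB Require Import structures.
From mathcomp Require Import all_boot all_order all_algebra.
From mathcomp Require Import boolp classical_sets reals sequences exp.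
From mathcomp Require Import zify ring lra.
Import Order.TTheory GRing.Theory Num.Theory.
Local Open Scope ring_scope.
Local Open Scope classical_set_scope.

Set Implicit Arguments.
Unset Strict Implicit.
Unset Printing Implicit Defensive.

(* A Transformer can realise arbitrary logits on a finite set of prompts (one layer
   of uniform attention followed by one hidden unit per prompt).  Since k >= 1, the
   first shot of a prompt spells out its vertex list, which has fewer than N chain
   vertices in training and exactly N in testing, so that training and test prompts
   never coincide.  Hence one can copy, on the training prompts, the logits of any
   parameters whose loss is within eps of the infimum and, on the test prompts,
   emit one fixed correct label: vertices and values of the label are determined by
   the input, and the goal vertex occurs only at the end of a chain of maximal
   length, so that greedy decoding does not stop too early. *)

(** * Realising arbitrary logits on finitely many prompts *)

Section Memorization.
Variables (R : realType) (Vall Ct : finType).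
Notation T := (tok Vall Ct).

(* Summed over the last position and the average over all positions, the score of [z]
   against [w] is [3 + 1 / size w] if [z = w] and at most 3 otherwise. *)
Definition match_score (w : seq T) (a : T) (i : nat) : nat :=
  if (i < size w)%N && (nth TDlm w i == a) then (i.+1 == size w).+1 else 0.

(** Each position contributes at most 1. The bonus sits at the last position of [w], which lies in
    the window scanned from [i] exactly when [i < size w <= i + size z]. The offset [i] is there for
    the induction. *)
Lemma sum_match_score_le (w z : seq T) (i : nat) :
  (\sum_(p <- zip z (iota i (size z))) match_score w p.1 p.2
    <= size z + (i < size w <= i + size z))%N.
Proof.
elim: z i => [|a z IH] i; first by rewrite big_nil.
rewrite /= big_cons /=; apply: leq_trans (leq_add (leqnn _) (IH _)) _.
by rewrite /match_score; case: ifP => [/andP[? _]|_]; lia.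
Qed.

(** If the last tokens agree, the bonus is offset by a mismatch elsewhere; if they differ, there is
    no bonus. *)
Lemma sum_match_score_lt (w z : seq T) (i : nat) :
  size w = (i + size z)%N -> drop i w <> z ->
  (\sum_(p <- zip z (iota i (size z))) match_score w p.1 p.2 <= size z)%N.
Proof.
elim: z i => [|a z IH] i sw; first by rewrite drop_oversize // sw addn0.
have iw : (i < size w)%N by rewrite sw /= ; lia.
rewrite (drop_nth TDlm) //= big_cons /= => ne.
case: (eqVneq (nth TDlm w i) a) => [e|ne2].
  have dz : drop i.+1 w <> z by move=> dz; apply: ne; rewrite e dz.
  have := IH i.+1 _ dz; rewrite sw /= addSnnS => /(_ erefl) IH'.
  have -> : match_score w a i = (z == [::]).+1.
    by rewrite /match_score iw e eqxx sw; case: (z) => [|b z'] /=; congr _.+1; lia.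
  case: z IH dz {ne} sw IH' => [|b z] _ dz sw IH'; last by rewrite add1n ltnS.
  by case: dz; rewrite drop_oversize // sw addn1.
rewrite /match_score iw /= (negbTE ne2) add0n.
apply: leq_trans (sum_match_score_le _ _ _) _; lia.
Qed.

Lemma sum_match_score_eq (w z : seq T) (i : nat) :
  size w = (i + size z)%N -> drop i w = z ->
  (\sum_(p <- zip z (iota i (size z))) match_score w p.1 p.2
    = size z + (z != [::]))%N.
Proof.
elim: z i => [|a z IH] i sw; first by rewrite big_nil.
have iw : (i < size w)%N by rewrite sw /= ; lia.
rewrite (drop_nth TDlm) //= big_cons /= => -[e1 e2].
rewrite IH //; last by rewrite sw /=; lia.
rewrite /match_score iw e1 eqxx /= sw.
by case: z {IH sw e2} => [|b z] /=; lia.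
Qed.

Variables (Z : seq (seq T)) (F : seq T -> T -> R).
Let n := size Z.

(** One coordinate and one hidden unit per prompt. Zero queries and keys make the softmax uniform,
    so that the residual connection supplies the score of the last position and the single head the
    average score. *)
Definition memorizer : tparams Vall Ct R :=
  @TP Vall Ct R n 1 1 n
    (fun a i => \col_j (match_score (nth [::] Z j) a i)%:R)
    (fun _ _ => 0) (fun _ _ => 0) (fun _ _ => 1%:M)
    (diag_mx (\row_j (size (nth [::] Z j))%:R))
    (\col_j - (3 * (size (nth [::] Z j))%:R))
    (fun a => \row_j F (nth [::] Z j) a).


Lemma attn_uniform (th : tparams Vall Ct R) (W : 'M[R]_(td th)) xs t :
  attn 0 0 W xs t =
  (size (take t.+1 xs))%:R^-1 *: (W *m \sum_(x <- take t.+1 xs) x).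
Proof.
rewrite /attn; set pre := take _ _.
pose O : 'M[R]_(td th) := 0; rewrite -/O.
have E (x : 'cV[R]_(td th)) : ((O *m x)^T *m (O *m nth 0 xs t)) 0 0 = 0.
  by rewrite !mul0mx mulmx0 mxE.
have -> : \sum_(x <- pre) expR (((O *m x)^T *m (O *m nth 0 xs t)) 0 0) = (size pre)%:R.
  rewrite -sum1_size natr_sum. apply: eq_bigr => x _; by rewrite E expR0.
rewrite mulmx_sumr scaler_sumr; apply: eq_bigr => x _.
by rewrite E expR0 mul1r.
Qed.

Lemma last_layer (th : tparams Vall Ct R) l xs : (0 < size xs)%N ->
  last 0 (@layer _ _ _ th l xs) =
  last 0 xs + \sum_(h < tH th) attn (tWQ l h) (tWK l h) (tWV l h) xs (size xs).-1.
Proof.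
move=> xs0; rewrite /layer -nth_last size_map size_iota.
by rewrite (nth_map 0%N) ?size_iota ?prednK // nth_iota ?prednK // add0n nth_last.
Qed.

Lemma memorizer_state (z : seq T) (j : 'I_n) : z != [::] ->
  (last 0 (forward memorizer z) : 'cV[R]_n) j 0 =
    (match_score (nth [::] Z j) (last TDlm z) (size z).-1)%:R +
    (\sum_(p <- zip z (iota 0 (size z))) match_score (nth [::] Z j) p.1 p.2)%:R
      / (size z)%:R.
Proof.
move=> z0; have sz : size (embed memorizer z) = size z.
  by rewrite size_map size_zip size_iota minnn.
have zgt : (0 < size z)%N by rewrite lt0n size_eq0.
have -> : last 0 (forward memorizer z) =
  last 0 (@layer _ _ _ memorizer ord0 (embed memorizer z)).
  by rewrite /forward [enum _]enum_ordSl /= enum_ord0.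
rewrite last_layer ?sz // big_ord_recl big_ord0 addr0.
rewrite [attn _ _ _ _ _](attn_uniform (th := memorizer) 1%:M) prednK //.
rewrite take_oversize ?sz // mul1mx [LHS]mxE [X in _ + X]mxE summxE -nth_last sz.
have zsz : ((size z).-1 < size (zip z (iota 0 (size z))))%N.
  by rewrite size_zip size_iota minnn prednK.
rewrite {2}/embed big_map mulrC natr_sum; congr (_ + _ / _).
  rewrite /embed (nth_map (TDlm, 0%N)) // mxE nth_zip ?size_iota //=.
  by rewrite nth_iota ?prednK // nth_last.
by apply: eq_bigr => p _; rewrite mxE.
Qed.

Lemma match_score_last (w z : seq T) : z != [::] ->
  match_score w (last TDlm z) (size z).-1 =
  if (size z <= size w)%N && (nth TDlm w (size z).-1 == last TDlm z)
  then (size z == size w).+1 else 0%N.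
Proof.
by rewrite -size_eq0 -lt0n => z0; rewrite /match_score prednK.
Qed.

(** The bias puts the threshold at score 3, and the factor [size w] rescales the excess [1 / size w]
    of an exact match to 1. *)
Lemma memorizer_hidden (z : seq T) (j : 'I_n) : z != [::] -> nth [::] Z j != [::] ->
  Num.max ((size (nth [::] Z j))%:R * (last 0 (forward memorizer z) : 'cV[R]_n) j 0
     - 3 * (size (nth [::] Z j))%:R) 0 = (z == nth [::] Z j)%:R.
Proof.
move=> z0 w0; rewrite memorizer_state //.
set w := nth [::] Z j in w0 *; set A := match_score _ _ _; set B := \sum_(p <- _) _.
have zgt : 0 < (size z)%:R :> R by rewrite ltr0n lt0n size_eq0.
have wgt : 0 < (size w)%:R :> R by rewrite ltr0n lt0n size_eq0.
case: eqVneq => [zw|zw].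
  have -> : A = 2%N.
    by rewrite /A match_score_last // zw leqnn nth_last !eqxx.
  have -> : B = (size z).+1.
    by rewrite /B sum_match_score_eq ?z0 ?addn1 // zw ?drop0.
  rewrite -natr1 zw; rewrite (_ : _ - _ = 1) ?max_l ?ler01 //.
  by field; rewrite gt_eqF.
(* A shorter [z] earns no bonus, and a longer one has [A = 0]. At equal length either [A = 0], or
   the last tokens agree and the mismatch lies before them, which gives [B <= size z]. *)
have AB : (A * size z + B <= 3 * size z)%N.
  have := sum_match_score_le w z 0; rewrite -/B.
  have : (0 < size z)%N by rewrite lt0n size_eq0.
  rewrite /A match_score_last //; case: ifP => [/andP[zw' _]|_]; last by lia.
  case: eqVneq => [e|]; last by lia.
  suff : (B <= size z)%N by lia.
  by apply: sum_match_score_lt; rewrite ?e // drop0; apply/eqP; rewrite eq_sym.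
move: AB; rewrite -(ler_nat R) natrD !natrM => AB.
rewrite max_r // subr_le0 mulrC ler_pM2r //.
by rewrite -(ler_pM2r zgt) mulrDl mulfVK ?gt_eqF.
Qed.

(** Since the prompts are distinct, the hidden layer is the one-hot vector at the index of [z], and
    the output row reads off the stored logit. *)
Lemma logit_memorizer (z : seq T) (a : T) :
  uniq Z -> [::] \notin Z -> z \in Z -> logit memorizer z a = F z a.
Proof.
move=> Zu Z0 zZ.
have z0 : z != [::] by apply: contraNneq Z0 => <-.
have zn : (index z Z < n)%N by rewrite index_mem.
have hid (j : 'I_n) : relu (tWO1 memorizer *m last 0 (forward memorizer z)
    + tWB memorizer) j 0 = (j == Ordinal zn)%:R.
  rewrite mxE /= mul_diag_mx mxE [X in Num.max (X + _)]mxE [X in Num.max (X * _ + _)]mxE.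
  rewrite [X in Num.max (_ + X)]mxE memorizer_hidden //.
    by rewrite -[in LHS](nth_index [::] zZ) nth_uniq ?size_Z // eq_sym.
  by apply: contraNneq Z0 => <-; apply: mem_nth.
rewrite /logit mxE (bigD1 (Ordinal zn)) //= big1 ?addr0 => [|j jz].
  by rewrite hid eqxx mulr1 mxE /= nth_index.
by rewrite hid (negbTE jz) mulr0.
Qed.

End Memorization.

Lemma exists_logits (R : realType) (Vall Ct : finType) (Z : seq (seq (tok Vall Ct)))
    (F : seq (tok Vall Ct) -> tok Vall Ct -> R) :
  exists th : tparams Vall Ct R, forall z a, z \in Z -> z != [::] -> logit th z a = F z a.
Proof.
exists (memorizer (undup (filter (predC1 [::]) Z)) F) => z a zZ z0.
by apply: logit_memorizer; rewrite ?undup_uniq ?mem_undup ?mem_filter /= ?eqxx ?z0.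
Qed.

(** * Finite distributions: listed outcomes and total mass *)

Section Distributions.
Variable R : realType.

(** Outcomes listed with weight 0 are included, so a property of all of [supp d] is at least as
    strong as an almost sure one. *)
Definition supp (T : Type) (d : dist R T) : seq T := map snd d.

Local Arguments supp : simpl never.

Lemma mem_supp_bind (A B : eqType) (d : dist R A) (f : A -> dist R B) b :
  b \in supp (dbind d f) -> exists2 a, a \in supp d & b \in supp (f a).
Proof.
case/mapP => -[r b'] /flattenP[_ /mapP[[q a] da ->] /mapP[[s c] fc [_ ->]]] /= ->.
by exists a; [exact: (map_f snd da) | exact: (map_f snd fc)].
Qed.

Lemma supp_ret (T : Type) (x : T) : supp (dret R x) = [:: x].
Proof. by []. Qed.

Lemma supp_unif (T : Type) (s : seq T) : supp (dunif R s) = s.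
Proof. by rewrite /supp /dunif -map_comp map_id. Qed.

Lemma is_dist_ret (T : Type) (x : T) : is_dist (dret R x).
Proof.
by split=> [p|]; rewrite ?big_seq1 // inE => /eqP ->; exact: ler01.
Qed.

Lemma is_dist_unif (T : eqType) (s : seq T) : (0 < size s)%N -> is_dist (dunif R s).
Proof.
move=> s0; split=> [p /mapP[_ /mapP[? _ ->] ->]|]; first by rewrite invr_ge0 ler0n.
rewrite big_map /= big_const_seq count_predT iter_addr_0.
by rewrite -[LHS]mulr_natr mulVf // pnatr_eq0 -lt0n.
Qed.

Lemma is_dist_bind (A B : eqType) (d : dist R A) (f : A -> dist R B) :
  is_dist d -> (forall a, a \in supp d -> is_dist (f a)) -> is_dist (dbind d f).
Proof.
move=> [d0 d1] fd; split.
  move=> _ /mapP[_ /flattenP[_ /mapP[[r a] da ->] /mapP[[s c] fc ->]] ->] /=.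
  apply: mulr_ge0; first exact: d0 (map_f fst da).
  exact: (fd a (map_f snd da)).1 (map_f fst fc).
rewrite /dbind big_flatten big_map -[RHS]d1 big_seq [RHS]big_seq.
apply: eq_bigr => -[r a] da; rewrite big_map /= -mulr_sumr.
by rewrite (fd a (map_f snd da)).2 mulr1.
Qed.

Lemma prob_eq1 (T : eqType) (d : dist R T) (P : T -> Prop) :
  is_dist d -> (forall x, x \in supp d -> P x) -> prob d P = 1.
Proof.
move=> [_ d1] dP; rewrite /prob -[RHS]d1 big_seq_cond [RHS]big_seq.
apply: eq_bigl => p; case pd: (p \in d) => //=.
by apply/asboolP/dP; exact: map_f.
Qed.

Lemma expect_le0 (T : eqType) (d : dist R T) (f : T -> R) :
  is_dist d -> (forall x, x \in supp d -> f x <= 0) -> expect d f <= 0.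
Proof.
move=> [d0 _] f0; rewrite /expect big_seq; apply: sumr_le0 => p pd.
by apply: mulr_ge0_le0; [exact: d0 (map_f fst pd) | exact: f0 (map_f snd pd)].
Qed.

Lemma eq_expect (T : eqType) (d : dist R T) (f g : T -> R) :
  (forall x, x \in supp d -> f x = g x) -> expect d f = expect d g.
Proof.
move=> fg; rewrite /expect; apply: eq_big_seq => p pd.
by rewrite fg // map_f.
Qed.

Lemma is_dist_draw (T : eqType) l (s : seq T) : (l <= size s)%N -> is_dist (draw R l s).
Proof.
elim: l s => [|l IH] s ls /=; first exact: is_dist_ret.
apply: is_dist_bind; first by apply: is_dist_unif; exact: leq_trans ls.
rewrite supp_unif => c cs; apply: is_dist_bind => [|r _]; last exact: is_dist_ret.
by apply: IH; rewrite size_rem //; lia.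
Qed.

Lemma supp_draw (T : eqType) l (s : seq T) r : r \in supp (draw R l s) -> {subset r <= s}.
Proof.
elim: l s r => [|l IH] s r /=; first by rewrite supp_ret inE => /eqP ->.
case/mem_supp_bind => c; rewrite supp_unif => cs.
case/mem_supp_bind => r' /IH r's; rewrite supp_ret inE => /eqP -> x.
by rewrite inE => /predU1P[->//|/r's/mem_rem].
Qed.

End Distributions.

Arguments supp : simpl never.

(** * Shape of sampled sequences and few-shot inputs *)

Section Sampling.
Variables (R : realType) (Vall Ct : finType) (S : cstruct Vall Ct).
Hypothesis wfS : wf_cstruct S.
Notation T := (tok Vall Ct).

Lemma is_dist_ctx v : is_dist (ctx S R v).
Proof.
have [_ _ /(_ v) C0 _ _] := wfS.
apply: is_dist_bind => [|l]; first by apply: is_dist_unif; rewrite size_iota.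
rewrite supp_unif mem_iota => /andP[l0 lC]; apply: is_dist_draw.
by rewrite -cardE -ltnS -add1n.
Qed.

Lemma supp_ctx v cs : cs \in supp (ctx S R v) -> {subset cs <= cCONT S v}.
Proof.
by case/mem_supp_bind => l _ /supp_draw sub c /sub; rewrite mem_enum.
Qed.

Lemma is_dist_gvals prev s : is_dist (gvals S R prev s).
Proof.
have V0 v : (0 < size (cVALS S v))%N.
  by have [_ /(_ v)[_ ?] _ _ _] := wfS; rewrite lt0n size_eq0.
elim: s prev => [|v s IH] prev /=; first exact: is_dist_ret.
case: ifP => _; apply: is_dist_bind.
- by case: prev => [[u q]|]; [exact: is_dist_ret | exact: is_dist_unif].
- by move=> q _; apply: is_dist_bind => // qs _; exact: is_dist_ret.
- exact: is_dist_unif.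
- by move=> q _; apply: is_dist_bind => // qs _; exact: is_dist_ret.
Qed.

Lemma is_dist_bodies ps : is_dist (bodies S R ps).
Proof.
elim: ps => [|[v q] ps IH] /=; first exact: is_dist_ret.
apply: is_dist_bind => [|cs _]; first exact: is_dist_ctx.
by apply: is_dist_bind => // bs _; exact: is_dist_ret.
Qed.

Lemma is_dist_sample s : is_dist (sample_seq S R s).
Proof.
case: s => [|v s]; first exact: is_dist_ret.
apply: is_dist_bind => [|qs _]; first exact: is_dist_gvals.
apply: is_dist_bind => [|bs _]; first exact: is_dist_bodies.
exact: is_dist_ret.
Qed.

Lemma is_dist_shots n s : is_dist (shots S R n s).
Proof.
elim: n => [|n IH] /=; first exact: is_dist_ret.
apply: is_dist_bind => [|x _]; first exact: is_dist_sample.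
by apply: is_dist_bind => // xs _; exact: is_dist_ret.
Qed.

Lemma is_dist_Dk (D : dist R (seq Vall)) k : is_dist D -> is_dist (Dk S D k).
Proof.
move=> dD; apply: is_dist_bind => // s _.
by apply: is_dist_bind => [|ss _]; [exact: is_dist_shots | exact: is_dist_ret].
Qed.

Definition good_pair (p : Vall * int) := p.2 \in cVALS S p.1.

(* [prev] is the last chain vertex seen together with its value *)
Definition extends (prev : option (Vall * int)) (s : seq Vall) : bool :=
  let c := [seq v <- s | v \in cV S] in
  if prev is Some (u, q) then (q \in cVALS S u) && path (cE S) u c
  else if c is u :: c' then path (cE S) u c' else true.

(** The recursion preserves [extends]: a noise vertex leaves [prev] alone, and at a chain vertex the
    edge operation maps the previous value into the new value set. *)
Lemma supp_gvals prev s qs : extends prev s -> qs \in supp (gvals S R prev s) ->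
  size qs = size s /\ all good_pair (zip s qs).
Proof.
have [_ _ _ _ opV] := wfS.
elim: s prev qs => [|v s IH] prev qs /=; first by rewrite supp_ret inE => _ /eqP ->.
rewrite /extends /=; case: ifP => vV ex.
  case/mem_supp_bind => q qv /mem_supp_bind[qs' qs'v].
  rewrite supp_ret inE => /eqP -> /=.
  have qV : q \in cVALS S v.
    case: prev ex qv => [[u q']|] /=; last by rewrite supp_unif.
    by case/and3P=> q'u uv _; rewrite supp_ret inE => /eqP ->; exact: opV.
  have [] := IH (Some (v, q)) qs' _ qs'v; last by move=> -> ->; rewrite /good_pair qV.
  rewrite /extends qV; case: prev ex {qv} => [[u q']|] //=.
  by case/and3P.
case/mem_supp_bind => q; rewrite supp_unif => qv /mem_supp_bind[qs' qs'v].
rewrite supp_ret inE => /eqP -> /=.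
by have [-> ->] := IH prev qs' ex qs'v; rewrite /good_pair qv.
Qed.

Fixpoint chain_pairs (u : Vall) (q : int) (s : seq Vall) : seq (Vall * int) :=
  if s is v :: s' then
    let q' := q + cop S u v in (v, q') :: chain_pairs v q' s'
  else [::].

Lemma unzip1_chain_pairs u q s : unzip1 (chain_pairs u q s) = s.
Proof. by elim: s u q => //= v s IH u q; rewrite IH. Qed.

(** Without noise, each value is forced by the preceding one. *)
Lemma supp_gvals_chain u q s qs : all (mem (cV S)) s ->
  qs \in supp (gvals S R (Some (u, q)) s) -> zip s qs = chain_pairs u q s.
Proof.
elim: s u q qs => [|v s IH] u q qs /=; first by rewrite supp_ret inE => _ /eqP ->.
case/andP => vV sV; rewrite vV.
case/mem_supp_bind => q'; rewrite supp_ret inE => /eqP ->.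
case/mem_supp_bind=> qs' qs'v; rewrite supp_ret inE => /eqP -> /=.
by rewrite (IH v (q + cop S u v)).
Qed.

Definition body (x : seq Ct * (Vall * int)) : seq T :=
  map TC x.1 ++ [:: TV x.2.1; TEq; TVal x.2.2].

Definition good_body (x : seq Ct * (Vall * int)) : bool :=
  good_pair x.2 && all (mem (cCONT S x.2.1)) x.1.

Lemma supp_bodies ps bs : all good_pair ps -> bs \in supp (bodies S R ps) ->
  exists xs, [/\ bs = map body xs, map snd xs = ps & all good_body xs].
Proof.
elim: ps bs => [|[v q] ps IH] bs /=.
  by rewrite supp_ret inE => _ /eqP ->; exists [::].
case/andP => gp gps /mem_supp_bind[cs /supp_ctx csC].
case/mem_supp_bind => bs' /IH -/(_ gps)[xs [-> <- gxs]].
rewrite supp_ret inE => /eqP ->; exists ((cs, (v, q)) :: xs); split=> //=.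
by rewrite gxs /good_body gp andbT; apply/allP.
Qed.

Lemma dec_body x r : dec (body x ++ r) = x.2 :: dec r.
Proof. by case: x => cs [v q]; rewrite /body; elim: cs. Qed.

Definition tail_of (xs : seq (seq Ct * (Vall * int))) : seq T :=
  flatten [seq TCm :: b | b <- map body xs].

Lemma dec_tail xs : dec (tail_of xs) = map snd xs.
Proof. by elim: xs => [|x xs IH] //=; rewrite -IH -dec_body. Qed.

Lemma assembleE (v : Vall) x xs : assemble v (map body (x :: xs)) =
  [:: TV v; TEq; TQu] ++ body x ++ tail_of xs.
Proof. by []. Qed.

(** The opening goal vertex is not decoded, because its [TEq] is followed by [TQu] and not by a
    value. *)
Lemma dec_assemble (v : Vall) xs : dec (assemble v (map body xs)) = map snd xs.
Proof. by case: xs => [|x xs] //; rewrite assembleE /= dec_body dec_tail. Qed.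

Lemma body_notin_cm x : TCm \notin body x.
Proof. by rewrite mem_cat negb_or; apply/andP; split=> //; apply/mapP => -[]. Qed.

Lemma body_notin_dlm x : TDlm \notin body x.
Proof. by rewrite mem_cat negb_or; apply/andP; split=> //; apply/mapP => -[]. Qed.

Lemma tail_notin_dlm xs : TDlm \notin tail_of xs.
Proof.
by elim: xs => //= x xs IH; rewrite in_cons mem_cat (negbTE (body_notin_dlm x)).
Qed.

Lemma assemble_notin_dlm (v : Vall) xs : TDlm \notin assemble v (map body xs).
Proof.
case: xs => [|x xs] //; rewrite assembleE mem_cat mem_cat.
by rewrite (negbTE (body_notin_dlm x)) (negbTE (tail_notin_dlm xs)).
Qed.

Lemma body_alphabet x : good_body x -> all (mem (alphabet S)) (body x).
Proof.
case: x => cs [v q] /andP[/= qv csC]; apply/allP => a; rewrite mem_cat => ain.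
change (a \in alphabet S); rewrite mem_undup; case/orP: ain => [/mapP[c cc ->]|].
  rewrite !mem_cat; apply/or4P; apply: Or43; apply/map_f.
  rewrite mem_filter mem_enum andbT; apply/existsP; exists v; exact: (allP csC).
rewrite !inE !mem_cat => /or3P[] /eqP ->.
- by rewrite map_f ?mem_enum.
- by rewrite !orbT.
apply/or4P; apply: Or42; apply/map_f/flattenP; exists (cVALS S v) => //.
by apply: map_f; rewrite mem_enum.
Qed.

Lemma tail_alphabet xs : all good_body xs -> all (mem (alphabet S)) (tail_of xs).
Proof.
elim: xs => //= x xs IH /andP[gx /IH gxs]; rewrite all_cat body_alphabet // gxs.
by rewrite mem_undup !mem_cat !inE !orbT.
Qed.

Definition label_of (xs : seq (seq Ct * (Vall * int))) : seq T :=
  if xs is y :: ys then body y ++ tail_of ys else [::].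

Lemma split_cm_cat (a b : seq T) : TCm \notin a -> split_cm (a ++ TCm :: b) = (rcons a TCm, b).
Proof.
move=> na; rewrite /split_cm index_cat (negbTE na) /= ?eqxx addn0 -cat_rcons.
by rewrite -(size_rcons a TCm) take_size_cat // drop_size_cat.
Qed.

Lemma split_cm_notin (a : seq T) : TCm \notin a -> split_cm a = (a, [::]).
Proof.
by move=> na; rewrite /split_cm (memNindex na) take_oversize // drop_oversize.
Qed.

(** Bodies are comma-free, so the first comma closes the first body. A one-vertex sequence has no
    comma; it goes entirely into the input and its label is empty. *)
Lemma split_cm_assemble (v : Vall) x xs : split_cm (assemble v (map body (x :: xs))) =
  ([:: TV v; TEq; TQu] ++ body x ++ (if xs is [::] then [::] else [:: TCm]), label_of xs).
Proof.
have na : TCm \notin [:: TV v; TEq; TQu] ++ body x by rewrite mem_cat (negbTE (body_notin_cm x)).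
rewrite assembleE catA; case: xs => [|y ys]; first by rewrite /= !cats0 split_cm_notin.
by rewrite split_cm_cat // -cats1 -catA.
Qed.

Lemma label_alphabet xs : all good_body xs -> all (mem (alphabet S)) (label_of xs).
Proof.
case: xs => //= y ys /andP[gy gys].
by rewrite all_cat body_alphabet ?tail_alphabet.
Qed.

Lemma dec_label xs : dec (label_of xs) = map snd xs.
Proof. by case: xs => //= y ys; rewrite dec_body dec_tail. Qed.

Lemma label_notin_dlm xs : TDlm \notin label_of xs.
Proof.
by case: xs => // y ys; rewrite mem_cat negb_or body_notin_dlm tail_notin_dlm.
Qed.

Lemma stopped_cat_body (p : seq T) x : stopped (TV x.2.1) (p ++ body x).
Proof.
by rewrite /stopped /body catA rev_cat /= eqxx.
Qed.

Lemma stopped_label y ys : stopped (TV (last y ys).2.1) (label_of (y :: ys)).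
Proof.
elim/last_ind: ys => [|ys z _]; first by rewrite /= cats0 (stopped_cat_body [::]).
rewrite last_rcons /= /tail_of !map_rcons flatten_rcons -cat_rcons catA.
exact: stopped_cat_body.
Qed.

(** * Reading the vertex list, the current sequence and the label progress off a prompt *)

Definition current (z : seq T) : seq T := drop (size z - index TDlm (rev z)) z.

(** Decodes the first shot, i.e. what precedes the first newline. *)
Definition skeleton (z : seq T) : seq Vall := unzip1 (dec (take (index TDlm z) z)).

Lemma current_cat (w c : seq T) : TDlm \notin c -> current (w ++ TDlm :: c) = c.
Proof.
move=> nc; rewrite /current -cat_rcons rev_cat index_cat mem_rev (negbTE nc).
rewrite rev_rcons /= ?eqxx addn0 size_rev size_cat addnK drop_size_cat //.
Qed.

Lemma goal_current (z : seq T) : goal z = nth TQu (current z) 0.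
Proof. by rewrite /current nth_drop addn0. Qed.

Lemma skeleton_cat (c w : seq T) : TDlm \notin c -> skeleton (c ++ TDlm :: w) = unzip1 (dec c).
Proof.
by move=> nc; rewrite /skeleton index_cat (negbTE nc) /= ?eqxx addn0 take_size_cat.
Qed.

Lemma supp_sample v s x : extends None (v :: s) ->
  x \in supp (sample_seq S R (v :: s)) ->
  exists qs xs, [/\ qs \in supp (gvals S R None (v :: s)), x = assemble (last v s) (map body xs),
    map snd xs = zip (v :: s) qs, unzip1 (map snd xs) = v :: s & all good_body xs].
Proof.
move=> ex /mem_supp_bind[qs qsv] /mem_supp_bind[bs].
have [sq gq] := supp_gvals ex qsv.
case/supp_bodies => // xs [-> xsz gxs]; rewrite supp_ret inE => /eqP ->.
by exists qs, xs; split=> //; rewrite xsz unzip1_zip // sq.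
Qed.

Lemma supp_shots n s ss : ss \in supp (shots S R n s) ->
  size ss = n /\ {subset ss <= supp (sample_seq S R s)}.
Proof.
elim: n ss => [|n IH] ss /=; first by rewrite supp_ret inE => /eqP ->.
case/mem_supp_bind => x xs /mem_supp_bind[ss' /IH[<- ss's]].
rewrite supp_ret inE => /eqP ->; split=> // y.
by rewrite inE => /predU1P[->//|/ss's].
Qed.

(** With at least one complete shot the input can be cut at its first newline, as [skeleton] does,
    and at its last one, as [current] does. *)
Lemma supp_kshot k s il : il \in supp (kshot S R k.+1 s) ->
  exists x1 w x, [/\ x1 \in supp (sample_seq S R s), x \in supp (sample_seq S R s),
    exists c, il.1 = x1 ++ TDlm :: c,
    il.1 = w ++ TDlm :: (split_cm x).1 & il.2 = (split_cm x).2].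
Proof.
case/mem_supp_bind => ss /supp_shots[sss sub]; rewrite supp_ret inE => /eqP ->.
set x := nth [::] ss k.+1; have xs : x \in ss by rewrite mem_nth // sss.
have sp : size (take k.+1 ss) = k.+1 by rewrite size_takel // sss.
have subp : {subset take k.+1 ss <= ss} by move=> y /mem_take.
case: (take _ _) sp subp => // x1 pre _ subp.
exists x1, (flatten [seq x0 ++ [:: TDlm] | x0 <- belast x1 pre] ++ last x1 pre), x.
have E : flatten [seq x0 ++ [:: TDlm] | x0 <- x1 :: pre] =
    (flatten [seq x0 ++ [:: TDlm] | x0 <- belast x1 pre] ++ last x1 pre) ++ [:: TDlm].
  by rewrite (lastI x1 pre) map_rcons flatten_rcons catA.
split=> //=; first exact/sub/subp/mem_head.
- exact: sub.
- by eexists; rewrite -!catA.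
- by move: E => /= ->; rewrite -catA.
Qed.

(** The suffix [r] stands for tokens generated so far; it comes after the first newline and cannot
    affect the skeleton. *)
Lemma kshot_shape k v s il r : extends None (v :: s) ->
  il \in supp (kshot S R k.+1 (v :: s)) ->
  [/\ skeleton (il.1 ++ r) = v :: s, all (mem (alphabet S)) il.2, TDlm \notin il.2 &
    exists w x ys qs, [/\ il.1 = w ++ TDlm :: [:: TV (last v s); TEq; TQu] ++ body x ++
       (if ys is [::] then [::] else [:: TCm]), il.2 = label_of ys,
       qs \in supp (gvals S R None (v :: s)) & map snd (x :: ys) = zip (v :: s) qs]].
Proof.
move=> ex /supp_kshot[x1 [w [x [/(supp_sample ex)[_ [xs1 [_ ex1 _ e1 _]]]]]]].
case/(supp_sample ex) => qs [[|y ys] [qsv -> ey e2 gys]] // [c ec] e3 e4.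
rewrite split_cm_assemble /= in e3 e4.
have /andP[gy {}gys] := gys.
rewrite e4 label_alphabet // label_notin_dlm; split=> //; last by exists w, y, ys, qs.
rewrite ec -catA cat_cons ex1 skeleton_cat ?assemble_notin_dlm //.
by rewrite dec_assemble.
Qed.

(** Two vertices guarantee a comma and a nonempty label. The value [q] of [v1] is visible in the
    input and determines all pairs of the label. *)
Lemma kshot_chain_shape k v1 v2 s il : extends None [:: v1, v2 & s] ->
  all (mem (cV S)) [:: v1, v2 & s] ->
  il \in supp (kshot S R k.+1 [:: v1, v2 & s]) ->
  exists w x y ys q, [/\ il.1 = w ++ TDlm :: [:: TV (last v2 s); TEq; TQu] ++ body x ++ [:: TCm],
    il.2 = label_of (y :: ys), x.2 = (v1, q) & map snd (y :: ys) = chain_pairs v1 q (v2 :: s)].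
Proof.
move=> ex sV /kshot_shape -/(_ [::] ex)[_ _ _ [w [x [ys [qs [-> -> qsv exs]]]]]].
move: sV qsv => /= /andP[v1V sV]; rewrite v1V.
case/mem_supp_bind => q _ /mem_supp_bind[qs' /(supp_gvals_chain (s := v2 :: s) sV) ch].
rewrite supp_ret inE => /eqP eqs; move: exs.
rewrite eqs -[zip _ _]/((v1, q) :: zip (v2 :: s) qs') ch.
by case: ys => [|y ys] [] // ex2 eys eys'; exists w, x, y, ys, q; rewrite /= eys eys'.
Qed.

(** The decoded label as a function of the input alone: vertices from the first shot, starting value
    from the current sequence, later values by the edge operations. *)
Definition expected (inp : seq T) : seq (Vall * int) :=
  if skeleton inp is v :: s then
    if dec (current inp) is (_, q) :: _ then chain_pairs v q s else [::]
  else [::].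

(** The number of label tokens already emitted, counted from the first comma of the current
    sequence. *)
Definition position (z : seq T) : nat := size (split_cm (current z)).2.

Lemma first_pair_notin_dlm (v : Vall) x (r : seq T) : TDlm \notin r ->
  TDlm \notin [:: TV v; TEq; TQu] ++ body x ++ TCm :: r.
Proof. by move=> nr; rewrite mem_cat negb_or /= mem_cat negb_or body_notin_dlm in_cons. Qed.

Section TestShot.
Variables (k : nat) (v1 v2 : Vall) (s : seq Vall) (il : seq T * seq T).
Hypotheses (ex : extends None [:: v1, v2 & s]) (sV : all (mem (cV S)) [:: v1, v2 & s]).
Hypothesis ilP : il \in supp (kshot S R k.+1 [:: v1, v2 & s]).

Lemma dec_test_label : dec il.2 = expected il.1.
Proof.
have [e _ _ _] := kshot_shape [::] ex ilP; rewrite cats0 in e.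
have [w [x [y [ys [q [e1 -> e2 e3]]]]]] := kshot_chain_shape ex sV ilP.
rewrite dec_label e3 /expected e e1 current_cat ?first_pair_notin_dlm //.
by rewrite /= dec_body e2.
Qed.

Lemma goal_test : goal il.1 = TV (last v2 s).
Proof.
have [w [x [y [ys [q [-> _ _ _]]]]]] := kshot_chain_shape ex sV ilP.
by rewrite goal_current current_cat ?first_pair_notin_dlm.
Qed.

Lemma stopped_test : stopped (goal il.1) il.2.
Proof.
rewrite goal_test.
have [w [x [y [ys [q [_ -> _ e]]]]]] := kshot_chain_shape ex sV ilP.
suff -> : last v2 s = (last y ys).2.1 by exact: stopped_label.
have := congr1 (last v1 \o unzip1) e; rewrite /= unzip1_chain_pairs => <-.
by rewrite /unzip1 -map_comp (last_map (fst \o snd)).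
Qed.

Lemma position_test r : TDlm \notin r -> position (il.1 ++ r) = size r.
Proof.
move=> nr.
have [w [x [y [ys [q [-> _ _ _]]]]]] := kshot_chain_shape ex sV ilP.
have -> : (w ++ TDlm :: [:: TV (last v2 s); TEq; TQu] ++ body x ++ [:: TCm]) ++ r =
    w ++ TDlm :: [:: TV (last v2 s); TEq; TQu] ++ body x ++ TCm :: r.
  by rewrite -catA cat_cons -[in LHS]catA -[in LHS]catA.
rewrite /position current_cat ?first_pair_notin_dlm // catA split_cm_cat //.
by rewrite mem_cat negb_or body_notin_cm.
Qed.

End TestShot.

End Sampling.

(** * Maximal chains, greedy decoding and the training loss *)

Section Decoding.
Variables (R : realType) (Vall Ct : finType) (S : cstruct Vall Ct).
Notation T := (tok Vall Ct).

Lemma is_chain_cat a x b :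
  is_chain S (a ++ x :: b) =
  (if a is u :: a' then (u \in cV S) && path (cE S) u (rcons a' x) else x \in cV S)
  && path (cE S) x b.
Proof. by case: a => [|u a] //=; rewrite -cat_rcons cat_path last_rcons andbA. Qed.

(* A repeated vertex closes a cycle, which could be run through once more. *)
Lemma max_chain_last N a x r : max_chain_len S N -> is_chain S (a ++ x :: r) ->
  size (a ++ x :: r) = N -> last x r = x -> r = [::].
Proof.
move=> [Nmax _] ch sN lx; have := Nmax (a ++ x :: r ++ r).
move: ch; rewrite !is_chain_cat cat_path lx => /andP[-> ->] /(_ erefl).
by rewrite -sN !size_cat /= size_cat => ?; apply/nilP; rewrite /nilp; lia.
Qed.

Lemma chain_in_V s : wf_cstruct S -> is_chain S s -> all (mem (cV S)) s.
Proof.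
move=> [EV _ _ _ _]; case: s => //= u s /andP[-> us] /=.
elim: s u us => //= v s IH u /andP[/EV/andP[_ vV] /IH ->]; by rewrite andbT.
Qed.

(** No decoded triple straddles the boundary: one begun in [p] would need [TEq] or a value where
    [TV v] stands. *)
Lemma dec_cat_body (p r : seq T) v q :
  dec (p ++ [:: TV v, TEq, TVal q & r]) = dec p ++ (v, q) :: dec r.
Proof.
(* Induction on the size, because [dec] may consume three tokens at once. *)
have [n] := ubnP (size p); elim: n p => // n IH [|a p] //= sp.
have IHp := IH p sp.
case: a => //= [u]; case: p sp IHp => [|b p] //= sp IHp.
case: b IHp => //= IHp; case: p sp IHp => [|c p] //= sp IHp.
case: c IHp => //= q' IHp; rewrite IH //; lia.
Qed.

Lemma stoppedP (g : Vall) (p : seq T) : stopped (TV g) p ->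
  exists p' q, p = p' ++ [:: TV g; TEq; TVal q].
Proof.
rewrite /stopped -{2}(revK p); case: (rev p) => [|a [|b [|c r]]] //=; case: a => //; case: b => //.
move=> q /eqP ->; exists (rev r), q.
by rewrite !rev_cons -!cats1 -!catA.
Qed.

(** Decoding follows [lab] and has stopped by its end, but it may stop at a proper prefix; whether
    pairs are lost then is a matter of the causal graph. *)
Lemma greedy_prefix sel (g : T) (inp lab : seq T) :
  (forall t, (t < size lab)%N -> sel (inp ++ take t lab) = nth TDlm lab t) ->
  lab != [::] -> stopped g lab ->
  exists fuel t, greedy sel g fuel inp [::] = Some (take t lab) /\ stopped g (take t lab).
Proof.
move=> selP l0 lg.
(* The fuel [n.+1] is the number of label tokens still to be emitted after the first [t]. *)
suff H n t : (t + n.+1 = size lab)%N -> exists t',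
    greedy sel g n.+1 inp (take t lab) = Some (take t' lab) /\ stopped g (take t' lab).
  exists (size lab).-1.+1; have [|t'] := H (size lab).-1 0%N; last by rewrite take0; exists t'.
  by rewrite add0n prednK // lt0n size_eq0.
elim: n t => [|n IH] t tn.
  exists t.+1; rewrite /= selP; last by lia.
  by rewrite -take_nth ?(take_oversize (n := t.+1)) ?lg //; lia.
rewrite [greedy]lock /= -lock.
have [st|st] := boolP (stopped g (take t.+1 lab)).
  exists t.+1; rewrite /= selP; last by lia.
  by rewrite -take_nth ?st //; lia.
have [|t' [e s']] := IH t.+1; first by lia.
exists t'; split=> //; rewrite -e [in LHS]/greedy -/greedy selP; last by lia.
by rewrite -take_nth ?(negbTE st) //; lia.
Qed.

(** Logit 1 against 0 leaves no tie, so the conclusion holds for every way of selecting an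
    argmax. *)
Lemma argmax_indicator (th : tparams Vall Ct R) sel z c :
  argmax_sel S th sel -> c \in alphabet S ->
  (forall a, logit th z a = (a == c)%:R) -> sel z = c.
Proof.
move=> /(_ z)[selA /(_ c) le] cA lg; have {le} := le cA.
rewrite /Pth ler_pM2r; last first.
  rewrite invr_gt0 (bigD1_seq c) ?undup_uniq //= ltr_wpDr ?expR_gt0 //.
  by apply: sumr_ge0 => *; exact: expR_ge0.
by rewrite ler_expR !lg eqxx; case: eqVneq => // _; rewrite ler10.
Qed.

Lemma Pth_le1 (th : tparams Vall Ct R) z a : a \in alphabet S -> Pth S th z a <= 1.
Proof.
move=> aA; rewrite /Pth (bigD1_seq a) ?undup_uniq //=.
have s0 : 0 <= \sum_(b <- alphabet S | b != a) expR (logit th z b).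
  by apply: sumr_ge0 => *; exact: expR_ge0.
rewrite ler_pdivrMr ?mul1r ?lerDl //.
by rewrite ltr_wpDr ?expR_gt0.
Qed.

Lemma supp_Dk (D : dist R (seq Vall)) P k il : all (fun p => P p.2) D ->
  il \in supp (Dk S D k) -> exists s, [/\ s \in supp D, P s & il \in supp (kshot S R k s)].
Proof.
move=> DP /mem_supp_bind[s sD ilP]; exists s; split=> //.
by case/mapP: sD => p pD ->; exact: (allP DP).
Qed.

Lemma train_skelP N s : train_skel S N s -> extends S None s /\ exists v s', s = v :: s'.
Proof.
rewrite /train_skel /extends; case: s => // v s /andP[ch _]; split; last by exists v, s.
by move: ch; case: (filter _ _) => //= u c /andP[].
Qed.

(** The count that separates training prompts from test prompts, whose skeleton has exactly [N]
    chain vertices. *)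
Lemma train_skeleton N (D : dist R (seq Vall)) k il r :
  wf_cstruct S -> all (fun p => train_skel S N p.2) D ->
  il \in supp (Dk S D k.+1) ->
  (size [seq v <- skeleton (il.1 ++ r) | v \in cV S] < N)%N /\ all (mem (alphabet S)) il.2.
Proof.
move=> wfS DP /(supp_Dk DP)[s [_ sP ilP]].
have [ex [v [s' es]]] := train_skelP sP; rewrite es in ex sP ilP.
have [-> -> _ _] := kshot_shape wfS r ex ilP.
by split=> //; case/andP: sP.
Qed.

(** Label tokens lie in the alphabet, so their probabilities are at most 1 and the logarithms at
    most 0. This bounds the loss below, as the infimum requires. *)
Lemma Ltrain_ge0 N (D : dist R (seq Vall)) K th :
  wf_cstruct S -> is_dist D -> all (fun p => train_skel S N p.2) D ->
  0 <= Ltrain S D K th.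
Proof.
move=> wfS dD DP; rewrite oppr_ge0 big_nat; apply: sumr_le0 => -[|k] //= _.
apply: expect_le0 => [|il ilP]; first exact: is_dist_Dk.
have [_ /allP lA] := train_skeleton [::] wfS DP ilP.
rewrite big_nat; apply: sumr_le0 => t /andP[_ ts].
by apply: ln_le0; apply: Pth_le1; apply: lA; exact: mem_nth.
Qed.

Lemma eq_Ltrain (D : dist R (seq Vall)) K (th th' : tparams Vall Ct R) :
  (forall k il t a, (1 <= k < K)%N -> il \in supp (Dk S D k) -> (1 <= t < size il.2)%N ->
     logit th (il.1 ++ take t il.2) a = logit th' (il.1 ++ take t il.2) a) ->
  Ltrain S D K th = Ltrain S D K th'.
Proof.
move=> eqth; congr (- _); apply: eq_big_nat => k kK.
apply: eq_expect => il ilP; apply: eq_big_nat => t tl.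
rewrite /Pth (eqth k) //; congr (ln (_ / _)).
by apply: eq_bigr => b _; rewrite (eqth k).
Qed.

End Decoding.

(** * Target logits and success on every test input *)

Section Optimum.
Variables (R : realType) (Vall Ct : finType) (S : cstruct Vall Ct).
Variables (N K : nat) (Dtr Dte : dist R (seq Vall)).
Notation T := (tok Vall Ct).

(** The shot numbers run from 2 to [K + 1], a finite range that contains all those tested. *)
Definition test_shots : seq (seq T * seq T) :=
  flatten [seq supp (Dk S Dte k) | k <- iota 2 K].

Definition train_shots : seq (seq T * seq T) :=
  flatten [seq supp (Dk S Dtr k) | k <- iota 1 K].

Lemma mem_shots (D : dist R (seq Vall)) a k il : (a <= k <= K)%N -> (0 < a)%N ->
  il \in supp (Dk S D k) -> il \in flatten [seq supp (Dk S D k) | k <- iota a K].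
Proof.
move=> aK a0 ilP; apply/flattenP; exists (supp (Dk S D k)) => //; apply: map_f.
by rewrite mem_iota; lia.
Qed.

(* The few-shot input fixes only the decoded label, not its context tokens, so one
   label of positive probability is singled out. *)
Definition canonical_label (inp : seq T) : seq T :=
  head [::] [seq il.2 | il <- test_shots & il.1 == inp].

Lemma canonical_label_shot il : il \in test_shots -> (il.1, canonical_label il.1) \in test_shots.
Proof.
move=> ilP; rewrite /canonical_label.
have : il \in [seq il' <- test_shots | il'.1 == il.1] by rewrite mem_filter eqxx.
case E : [seq _ <- _ | _] => [|[i l] q] //= _.
have : (i, l) \in [seq il' <- test_shots | il'.1 == il.1] by rewrite E mem_head.
by rewrite mem_filter => /andP[/eqP /= ->].
Qed.

(** Removing the emitted label tokens from [z] recovers the few-shot input; the next token of its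
    canonical label follows. *)
Definition target (z : seq T) : T :=
  nth TDlm (canonical_label (take (size z - position z) z)) (position z).

Definition target_logit (th0 : tparams Vall Ct R) (z : seq T) (a : T) : R :=
  if (size [seq v <- skeleton z | v \in cV S] < N)%N then logit th0 z a
  else (a == target z)%:R.

(** Here [t] starts at 0, since decoding must also produce the first label token, whereas the loss
    is summed from [t = 1]. *)
Definition prompts : seq (seq T) :=
  flatten [seq [seq il.1 ++ take t il.2 | t <- iota 0 (size il.2)]
          | il <- train_shots ++ test_shots].

Lemma mem_prompts il t : il \in train_shots ++ test_shots -> (t < size il.2)%N ->
  il.1 ++ take t il.2 \in prompts.
Proof.
move=> ilP tl; apply/flattenP; eexists; first exact: (map_f _ ilP).
by apply: (map_f (fun t => _ ++ take t _)); rewrite mem_iota.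
Qed.

Hypotheses (wfS : wf_cstruct S) (maxN : max_chain_len S N).
Hypotheses (trP : all (fun p => train_skel S N p.2) Dtr)
  (teP : all (fun p => test_skel S N p.2) Dte).
Hypothesis N2 : (2 <= N)%N.

Lemma test_skelP s : test_skel S N s -> exists v1 v2 s',
  [/\ s = [:: v1, v2 & s'], extends S None s & all (mem (cV S)) s].
Proof.
case/andP => ch /eqP sN; have sV := chain_in_V wfS ch.
move: sN N2 ch sV; case: s => [<- //|v1 [<- //|v2 s]] _ _ ch sV.
exists v1, v2, s; split=> //; rewrite /extends.
by move/all_filterP: (sV) ch => -> /andP[].
Qed.

Lemma test_shotsP il : il \in test_shots -> exists k v1 v2 s,
  [/\ test_skel S N [:: v1, v2 & s], extends S None [:: v1, v2 & s],
    all (mem (cV S)) [:: v1, v2 & s] & il \in supp (kshot S R k.+1 [:: v1, v2 & s])].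
Proof.
case/flattenP => _ /mapP[k ki ->]; case: k ki => [|k _]; first by rewrite mem_iota.
case/(supp_Dk teP) => s [_ sP].
by have [v1 [v2 [s' [es ? ?]]]] := test_skelP sP; subst s; exists k, v1, v2, s'.
Qed.

Variables (th0 th : tparams Vall Ct R).
Hypothesis th_logit : forall z a, z \in prompts -> z != [::] -> logit th z a = target_logit th0 z a.

Lemma Ltrain_copied : Ltrain S Dtr K th = Ltrain S Dtr K th0.
Proof.
apply: eq_Ltrain => -[|k] //= il t a kK ilP /andP[t0 tl].
have [sk _] := train_skeleton (take t il.2) wfS trP ilP.
rewrite th_logit; first by rewrite /target_logit sk.
  by apply: mem_prompts => //; rewrite mem_cat (mem_shots (a := 1) _ _ ilP) //= ltnW.
by rewrite -size_eq0 size_cat size_takel ?(ltnW tl) // addn_eq0 negb_and -!lt0n t0 orbT.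
Qed.

Lemma success_test sel il : argmax_sel S th sel -> il \in test_shots -> success sel il.1 il.2.
Proof.
move=> selP ilP; have labP := canonical_label_shot ilP.
set lab := canonical_label il.1 in labP.
(* Both labels decode to [expected il.1], so it suffices to reach the canonical one. *)
have ->// : success sel il.1 il.2 = success sel il.1 lab.
  have [k [v1 [v2 [s [_ ex sV /(dec_test_label wfS ex sV) e]]]]] := test_shotsP ilP.
  have [k' [u1 [u2 [s' [_ ex' sV' /(dec_test_label wfS ex' sV') /= e']]]]] := test_shotsP labP.
  by rewrite /success e e'.
have [k [v1 [v2 [s [sP ex sV kP]]]]] := test_shotsP labP.
have [/andP[ch /eqP sN]] := sP.
have [_ /allP /= labA labD _] := kshot_shape wfS [::] ex kP.
have := stopped_test wfS ex sV kP; have gE := goal_test wfS ex sV kP; rewrite /= gE => st.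
have lab0 : lab != [::] by apply: contraTneq st => ->.
have selE t : (t < size lab)%N -> sel (il.1 ++ take t lab) = nth TDlm lab t.
  move=> tl; apply: (argmax_indicator selP) => [|a]; first by apply: labA; exact: mem_nth.
  have pos : position (il.1 ++ take t lab) = t.
    rewrite (position_test wfS ex sV kP) ?size_takel ?(ltnW tl) //.
    by apply: contra labD; exact: mem_take.
  have [sk _ _ _] := kshot_shape wfS (take t lab) ex kP.
  rewrite th_logit; last 1 first.
  - by apply/eqP => z0; rewrite z0 in sk.
  (* The skeleton has exactly [N] chain vertices, so the indicator branch of [target_logit]
     applies. *)
  - rewrite /target_logit sk (all_filterP sV) sN ltnn /target pos size_cat.
    by rewrite size_takel ?(ltnW tl) // addnK take_size_cat.
  - by apply: (mem_prompts (il := (il.1, lab))) => //; rewrite mem_cat labP orbT.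
have [fuel [t [gr]]] := greedy_prefix selE lab0 st.
(* The output ends with the goal vertex. It remains to see that the part of [lab] not emitted
   contains no further pair. *)
case/stoppedP => p [q ep]; exists fuel, (take t lab); rewrite gE gr; split=> //.
have [_ [_ [y [ys [q' [_ labE _ ysE]]]]]] := kshot_chain_shape wfS ex sV kP.
have pairs : unzip1 (dec lab) = v2 :: s.
  by rewrite -[lab]/((il.1, lab).2) labE dec_label ysE unzip1_chain_pairs.
have decE : dec lab = dec p ++ (last v2 s, q) :: dec (drop t lab).
  by rewrite -{1}(cat_take_drop t lab) ep -catA dec_cat_body.
suff rest0 : dec (drop t lab) = [::] by rewrite ep dec_cat_body decE rest0.
apply/nilP; rewrite /nilp -(size_map fst); apply/nilP.
(* The chain is cut at the occurrence of the goal vertex where decoding stopped. What follows would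
   lead back to that vertex, which maximality forbids unless it is empty. *)
have cat_s : [:: v1, v2 & s] = (v1 :: unzip1 (dec p)) ++ last v2 s :: unzip1 (dec (drop t lab)).
  by rewrite /= -pairs decE /unzip1 map_cat.
apply: (max_chain_last maxN (a := v1 :: unzip1 (dec p)) (x := last v2 s)); rewrite -?cat_s //.
by move: (congr1 (last v1) cat_s); rewrite last_cat /= => <-.
Qed.

End Optimum.

Theorem theorem1 (R : realType) (Vall Ct : finType) (S : cstruct Vall Ct)
  (N K : nat) (Dtr Dte : dist R (seq Vall)) :
  wf_cstruct S -> max_chain_len S N ->
  is_dist Dtr -> all (fun p => train_skel S N p.2) Dtr ->
  is_dist Dte -> all (fun p => test_skel S N p.2) Dte ->
  forall eps : R, 0 < eps ->
  exists th : tparams Vall Ct R,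
    `| Ltrain S Dtr K th - inf (range (Ltrain S Dtr K)) | < eps /\
    (forall sel, argmax_sel S th sel ->
       forall k, (2 <= k <= K)%N -> test_acc S Dte k sel = 1).
Proof.
move=> wfS maxN dtr trP dte teP eps eps0.
(* Total mass 1 makes [Dtr] nonempty, and a training skeleton contains a nonempty chain of fewer
   than [N] vertices. *)
have N2 : (2 <= N)%N.
  case: Dtr dtr trP => [[_ /eqP]|p D _ /= /andP[/andP[]]].
    by rewrite big_nil eq_sym oner_eq0.
  by case: (filter _ _) => // v s _ + _; exact: leq_ltn_trans.
have lbL : lbound (range (Ltrain S Dtr K)) 0.
  by move=> _ [th _ <-]; exact: Ltrain_ge0 dtr trP.
(* Any parameters will do here: they show that the set of losses is nonempty. *)
have [th1 _] := exists_logits (R := R) [::] (fun (_ : seq (tok Vall Ct)) _ => 0).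
have infL : has_inf (range (Ltrain S Dtr K)).
  by split; [exists (Ltrain S Dtr K th1), th1 | exists 0].
(* The infimum may not be attained, so [th0] is only within [eps] of it; its loss is then copied
   exactly. *)
have [_ [th0 _ <-] th0P] := inf_adherent eps0 infL.
have [th thP] := exists_logits (prompts S K Dtr Dte) (target_logit S N K Dte th0).
exists th; split=> [|sel selP k kK].
  rewrite ger0_norm ?subr_ge0; last by apply: ge_inf; [exists 0 | exists th].
  by rewrite ltrBlDl (Ltrain_copied wfS trP thP).
apply: prob_eq1 => [|il ilP]; first exact: is_dist_Dk.
apply: (success_test wfS maxN teP N2 thP selP); exact: mem_shots ilP.
Qed.
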